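(* Consider a set of producers $\mathcal N=\{1,\dots,n\}$, quadratic production cost functions $C_i(q)=c_iq^2/2$ with $c_i>0$ for every $i\in\mathcal N$, and the affine demand function $D(p)=\gamma(\hat p-p)$ with $\gamma>0$, $\hat p>0$. Let $$p^*_\infty=\lim_{K\to+\infty}p^*_K=\frac{\gamma\hat p}{\gamma+\sum_{i=1}^n1/c_i}$$ be the limit as $K\to+\infty$ of the market-clearing price $p^*_K$ at any Nash equilibrium of the $\mathrm{Lip}_K$-pay-as-bid auction game, and let $$p^*_{\mathrm{SFE}}=\frac{\gamma\hat p}{\gamma+\sum_{i=1}^n\beta_i}$$ be the market-clearing price of any linear supply function equilibrium $S_i(p)=\beta_ip$, $i\in\mathcal N$. Then $$p^*_\infty<p^*_{\mathrm{SFE}}.$$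
   Context: Notation: $\mathbb R_+=[0,\infty)$; $\mathcal N$ is non-empty and finite. Linear supply function equilibria (of the uniform-price model): the supply functions $S_i(p)=\beta_ip$ form a linear supply function equilibrium if and only if, for every $i\in\mathcal N$, $\beta_i\ge0$ and $$\beta_i=(1-c_i\beta_i)\Big(\gamma+\sum_{j\ne i}\beta_j\Big)$$ (this characterization is taken as the definition here). $\mathrm{Lip}_K$ is the set of non-decreasing functions $F:[0,\hat p]\to\mathbb R_+$ with $F(0)=0$ and $|F(x)-F(y)|\le K|x-y|$ for all $x,y\in[0,\hat p]$. The $\mathrm{Lip}_K$-pay-as-bid auction game is the strategic game with player set $\mathcal N$, where each player $i$ chooses $S_i\in\mathrm{Lip}_K$. Given $S=(S_1,\dots,S_n)$, the market-clearing price $p^*(S)$ is the unique $p^*\in[0,\hat p]$ with $D(p^* )=\sum_{i=1}^nS_i(p^* )$, and the utility of player $i$ is $$u_i(S)=p^*S_i(p^* )-\int_0^{p^*}S_i(p)\,dp-C_i(S_i(p^* )),\qquad p^*=p^*(S).$$ $S^*$ is a Nash equilibrium if for every $i$, $S_i^*$ maximizes $u_i(\cdot,S_{-i}^* )$ over $\mathrm{Lip}_K$; $p_K^*=p^*(S^* )$ for any Nash equilibrium $S^*$.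
   Formalization: The limit of p*_K is identified with the closed formula only for n ≥ 2: for a single producer (e.g. c=γ=p̂=1) p*_K tends to 2/3 = p*_SFE rather than 1/2; for n=1 the strict inequality is stated for the closed formula only. *)

(* Defs.v *)
From HB Require Import structures.
From mathcomp Require Import all_boot all_order all_algebra.
From mathcomp Require Import all_classical all_reals all_analysis.
From mathcomp Require Import lra.

Set Implicit Arguments.
Unset Strict Implicit.
Unset Printing Implicit Defensive.

Import Order.TTheory GRing.Theory Num.Theory.
Import numFieldNormedType.Exports.

Local Open Scope classical_set_scope.
Local Open Scope ring_scope.

Definition quadratic_cost (R : realType) (c q : R) : R := c * q ^+ 2 / 2.

Definition affine_demand (R : realType) (gamma phat p : R) : R :=
  gamma * (phat - p).

(* Supply functions have domain [0, phat]; they are represented by functions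
   R -> R, of which only the values on [0, phat] are ever constrained or used. *)
Definition Lip_supply (R : realType) (phat K : R) (F : R -> R) : Prop :=
  [/\ F 0 = 0,
      {in `[0, phat], forall x, 0 <= F x},
      {in `[0, phat] &, {homo F : x y / x <= y}} &
      {in `[0, phat] &, forall x y, `|F x - F y| <= K * `|x - y|}].

Definition clears (R : realType) (n : nat) (gamma phat : R)
    (S : 'I_n -> R -> R) (p : R) : Prop :=
  p \in `[0, phat] /\ affine_demand gamma phat p = \sum_(i < n) S i p.

(* The default value 0 is irrelevant when a clearing price exists and is
   unique; see clearing_priceE for non-decreasing supply functions. *)
Definition clearing_price (R : realType) (n : nat) (gamma phat : R)
    (S : 'I_n -> R -> R) : R :=
  xget 0 [set p | clears gamma phat S p].

Definition utility (R : realType) (n : nat) (c : 'I_n -> R) (gamma phat : R)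
    (S : 'I_n -> R -> R) (i : 'I_n) : R :=
  let p := clearing_price gamma phat S in
  p * S i p - \int[lebesgue_measure]_(x in `[0, p]) S i x
  - quadratic_cost (c i) (S i p).

Definition Nash_equilibrium (R : realType) (n : nat) (c : 'I_n -> R)
    (gamma phat K : R) (S : 'I_n -> R -> R) : Prop :=
  (forall i, Lip_supply phat K (S i)) /\
  forall (i : 'I_n) (F : R -> R), Lip_supply phat K F ->
    utility c gamma phat [eta S with i |-> F] i <= utility c gamma phat S i.

(* p is "the" market-clearing price at any Nash equilibrium: equilibria exist,
   and all of them have clearing price p. *)
Definition is_equilibrium_price (R : realType) (n : nat) (c : 'I_n -> R)
    (gamma phat K p : R) : Prop :=
  (exists S, Nash_equilibrium c gamma phat K S) /\
  forall S, Nash_equilibrium c gamma phat K S ->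
    clearing_price gamma phat S = p.

Definition linear_SFE (R : realType) (n : nat) (c : 'I_n -> R) (gamma : R)
    (beta : 'I_n -> R) : Prop :=
  forall i, 0 <= beta i /\
    beta i = (1 - c i * beta i) * (gamma + \sum_(j < n | j != i) beta j).

Definition linear_supply (R : realType) (n : nat) (beta : 'I_n -> R)
    (i : 'I_n) (p : R) : R := beta i * p.

Lemma clears_uniq (R : realType) (n : nat) (gamma phat : R)
    (S : 'I_n -> R -> R) (p q : R) :
  0 < gamma -> (forall i, {in `[0, phat] &, {homo S i : x y / x <= y}}) ->
  clears gamma phat S p -> clears gamma phat S q -> p = q.
Proof.
move=> g0 Sm; wlog lepq : p q / p <= q => [hw cp cq|[pI Ep] [qI Eq]].
  have [h|/ltW h] := leP p q; first exact: hw.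
  by apply/esym; apply: hw.
have : \sum_(i < n) S i p <= \sum_(i < n) S i q.
  by apply: ler_sum => i _; apply: Sm.
rewrite -Ep -Eq /affine_demand ler_pM2l// => h.
by apply/le_anti; rewrite lepq /=; lra.
Qed.

Lemma clearing_priceE (R : realType) (n : nat) (gamma phat : R)
    (S : 'I_n -> R -> R) (p : R) :
  0 < gamma -> (forall i, {in `[0, phat] &, {homo S i : x y / x <= y}}) ->
  clears gamma phat S p -> clearing_price gamma phat S = p.
Proof.
move=> g0 Sm cp; apply: (clears_uniq g0 Sm) => //.
exact: (@xgetPex _ 0 [set p | clears gamma phat S p]) (ex_intro _ p cp).
Qed.

Lemma clearing_price_clears (R : realType) (n : nat) (gamma phat K : R)
    (S : 'I_n -> R -> R) :
  0 < gamma -> 0 < phat -> (forall i, Lip_supply phat K (S i)) ->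
  clears gamma phat S (clearing_price gamma phat S).
Proof.
move=> g0 ph0 SL; apply: (@xgetPex _ 0 [set p | clears gamma phat S p]).
pose f x := \sum_(i < n) S i x - affine_demand gamma phat x.
have fc : {within `[0, phat], continuous f}.
  have Lf : {in `[0, phat] &, forall x y,
      `|f x - f y| <= (`|K| * n%:R + gamma) * `|x - y|}.
    move=> x y xI yI.
    have -> : f x - f y = \sum_(i < n) (S i x - S i y) + gamma * (x - y).
      by rewrite /f /affine_demand sumrB; lra.
    rewrite mulrDl (le_trans (ler_normD _ _))// lerD//; last first.
      by rewrite normrM gtr0_norm.
    apply: (le_trans (ler_norm_sum _ _ _)).
    apply: (@le_trans _ _ (\sum_(i < n) `|K| * `|x - y|)).
      apply: ler_sum => i _; have [_ _ _ h] := SL i.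
      by rewrite (le_trans (h x y xI yI))// ler_wpM2r// ler_norm.
    by rewrite sumr_const card_ord mulrAC mulr_natr lexx.
  have M0 : 0 < `|K| * n%:R + gamma by rewrite ltr_wpDl// mulr_ge0.
  apply/subspace_continuousP => x xI; apply/cvgrPdist_le => e e0.
  rewrite near_withinE; near=> y => yI.
  apply: (le_trans (Lf x y xI yI)).
  rewrite mulrC -ler_pdivlMr//; near: y.
  have d0 : 0 < e / (`|K| * n%:R + gamma) by rewrite divr_gt0.
  by have /cvgrPdist_le/(_ _ d0) := @cvg_id _ (nbhs x).
have f0 : f 0 = - (gamma * phat).
  rewrite /f big1; first by rewrite /affine_demand; lra.
  by move=> i _; have [] := SL i.
have fp : 0 <= f phat.
  rewrite /f /affine_demand subrr mulr0 subr0 sumr_ge0// => i _.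
  by have [_ h _ _] := SL i; apply: h; rewrite in_itv /= lexx ltW.
have f0le : f 0 <= 0 by rewrite f0 oppr_le0 mulr_ge0 ?ltW.
have [|p pI fp0] := IVT (ltW ph0) fc (v := 0).
  by rewrite ge_min le_max f0le fp orbT.
by exists p; split=> //; apply/eqP; rewrite eq_sym -subr_eq0 -/(f p) fp0.
Unshelve. all: by end_near.
Qed.

(* Main.v *)
Require Import Defs.
From HB Require Import structures.
From mathcomp Require Import all_boot all_order all_algebra.
From mathcomp Require Import all_classical all_reals all_analysis.
From mathcomp Require Import ring lra.

Set Implicit Arguments.
Unset Strict Implicit.
Unset Printing Implicit Defensive.

Import Order.TTheory GRing.Theory Num.Theory.
Import numFieldNormedType.Exports.

Local Open Scope classical_set_scope.
Local Open Scope ring_scope.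

(** Why the theorem is true.  A player who sells the quantity [q] at the price
    [p] is paid [p * q] minus the area under the supply function, so the supply
    offered at prices below [p] should be as small as possible: among the
    admissible functions through [(p, q)] the smallest is the ramp
    [max 0 (q - K (p - x))], whose area is [q ^ 2 / (2 K)].  Hence
    [u_i <= p q - kappa_i q ^ 2 / 2] with
    [kappa_i = c_i + 1 / K], with equality for ramps ([utility_le_bid_profit],
    [utility_ramp]), and the game reduces to choosing the best point on the
    residual demand curve.

    At a Nash equilibrium with clearing price [p] every player sells a positive
    quantity [q_i] ([Nash_sold_gt0]), and just below [p] every supply function
    is exactly a line of slope [K] ([Nash_steep]); so the residual demand has
    slope [- G], [G = gamma + K (n - 1)], immediately to the left of [p].
    To the right of [p] the supply functions are only known to be [K]-Lipschitz, so the residual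
    demand falls at rate at most [G].  Deviations to the left give
    [G (p - kappa_i q_i) <= q_i] and deviations to the right give the opposite
    inequality ([Nash_left_deviation], [Nash_right_deviation]).  Therefore
    [q_i = b_i p] with [b_i = 1 / (c_i + 1 / K + 1 / G)], and market clearing
    determines [p] ([Nash_price]).

    Conversely, the ramps through the points [(p, b_i p)] form an equilibrium
    ([Nash_exists]): the residual demand of each player lies below its tangent
    line of slope [- G] at [p], and along that line the profit is a concave
    quadratic, maximal at [b_i p].

    When [n > 1], [G] tends to infinity with [K], so [b_i] tends to [1 / c_i].
    Finally a linear supply function equilibrium has [beta_i < 1 / c_i], since
    otherwise the right-hand side of its defining equation is nonpositive while
    [beta_i > 0] ([linear_SFE_lt]); this makes its clearing price strictly
    larger. *)

(** * Integrals of monotone Lipschitz functions *)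

(** [F] is [K]-Lipschitz on the segment [a, b]; nothing is said elsewhere. *)
Definition lipschitz_on (R : realType) (a b K : R) (F : R -> R) : Prop :=
  {in `[a, b] &, forall x y, `|F x - F y| <= K * `|x - y|}.

Lemma lipschitz_onS (R : realType) (a b a' b' K : R) (F : R -> R) :
  a <= a' -> b' <= b -> lipschitz_on a b K F -> lipschitz_on a' b' K F.
Proof.
move=> aa bb LF x y; rewrite !in_itv/= => /andP[ax xb] /andP[ay yb].
by apply: LF; rewrite in_itv/=; apply/andP; split; lra.
Qed.

Lemma lipschitz_on_integrable (R : realType) (a b K : R) (F : R -> R) :
  lipschitz_on a b K F -> lebesgue_measure.-integrable `[a, b] (EFin \o F).
Proof.
move=> LF; apply: continuous_compact_integrable; first exact: segment_compact.
have K1 : 0 < `|K| + 1 by rewrite ltr_wpDl.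
apply/subspace_continuousP => x xI; apply/cvgrPdist_le => e e0.
rewrite near_withinE; near=> y => yI.
apply: (le_trans (LF x y xI yI)).
apply: (@le_trans _ _ ((`|K| + 1) * `|x - y|)).
  by rewrite ler_wpM2r// (le_trans (ler_norm _))// lerDl.
rewrite mulrC -ler_pdivlMr//; near: y.
have d0 : 0 < e / (`|K| + 1) by rewrite divr_gt0.
by have /cvgrPdist_le/(_ _ d0) := @cvg_id _ (nbhs x).
Unshelve. all: by end_near.
Qed.

Lemma Rintegral_segment_split (R : realType) (a x b : R) (F : R -> R) :
  lebesgue_measure.-integrable `[a, b] (EFin \o F) -> a <= x <= b ->
  \int[lebesgue_measure]_(t in `[a, b]) F t =
  \int[lebesgue_measure]_(t in `[a, x]) F t +
  \int[lebesgue_measure]_(t in `[x, b]) F t.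
Proof.
move=> iF /andP[ax xb].
rewrite -[X in _ + X]Rintegral_itv_obnd_cbnd.
  by rewrite -(Rintegral_itvB iF) ?bnd_simp// addrC subrK.
by apply: integrableS iF => //; apply: subset_itvr; rewrite bnd_simp.
Qed.

Lemma Rintegral_segment_cst (R : realType) (a b s : R) : a <= b ->
  \int[lebesgue_measure]_(t in `[a, b]) s = s * (b - a).
Proof.
move=> ab; rewrite Rintegral_cst//= lebesgue_measure_itv/= lte_fin.
have [//|ba] := ltP a b.
by have -> : a = b by [apply/le_anti/andP]; rewrite subrr.
Qed.

Lemma lipschitz_on_affine (R : realType) (a b K s d : R) : 0 <= K ->
  lipschitz_on a b K (fun x => s + K * (x - d)).
Proof.
move=> K0 x y _ _.
have -> : s + K * (x - d) - (s + K * (y - d)) = K * (x - y) by ring.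
by rewrite normrM ger0_norm.
Qed.

Lemma Rintegral_segment_affine (R : realType) (a b s K : R) :
  0 <= K -> a <= b ->
  \int[lebesgue_measure]_(t in `[a, b]) (s + K * (t - a)) =
  s * (b - a) + K * (b - a) ^+ 2 / 2.
Proof.
move=> K0; rewrite le_eqVlt => /predU1P[->|ab].
  by rewrite set_itv1 Rintegral_set1; ring.
pose G x := s * x + K / 2 * (x - a) ^+ 2 : R.
have dG (x : R) : is_derive x 1 G (s + K * (x - a)).
  apply: is_derive_eq; rewrite /GRing.scale/=.
  by field.
have Gc (x : R) : {for x, continuous G}.
  apply: differentiable_continuous; apply/derivable1_diffP.
  by have [] := dG x.
have fc : {within `[a, b], continuous (fun x : R => s + K * (x - a))}.
  apply: continuous_subspaceT => x; apply: cvgD; first exact: cvg_cst.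
  by apply: cvgMr; apply: cvgB; [exact: cvg_id|exact: cvg_cst].
have dGab : derivable_oo_LRcontinuous G a b.
  split; first by move=> x _; have [] := dG x.
    by apply: cvg_at_right_filter; exact: Gc.
  by apply: cvg_at_left_filter; exact: Gc.
rewrite /Rintegral (continuous_FTC2 ab fc dGab) /=; first by rewrite /G; field.
by move=> x _; rewrite derive1E; have [_ ->] := dG x.
Qed.

(** Among the monotone [K]-Lipschitz functions with prescribed values at [a] and
    [b], the smallest one stays at [F a] and then climbs to [F b] with slope
    [K]; the left-hand side is its integral. *)
Lemma monotone_Rintegral_ge (R : realType) (a b K : R) (F : R -> R) :
  0 < K -> a <= b -> {in `[a, b] &, {homo F : x y / x <= y}} ->
  lipschitz_on a b K F ->
  F a * (b - a) + (F b - F a) ^+ 2 / (2 * K) <=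
  \int[lebesgue_measure]_(t in `[a, b]) F t.
Proof.
move=> K0 ab mF LF; have Kn0 : K != 0 by rewrite gt_eqF.
have aI : a \in `[a, b] by rewrite in_itv/= lexx.
have bI : b \in `[a, b] by rewrite in_itv/= lexx andbT.
(* The point where the smallest such function starts to climb. *)
pose d := b - (F b - F a) / K.
have Kd : K * (b - d) = F b - F a by rewrite /d; field.
have ad : a <= d.
  rewrite /d lerBrDr -lerBrDl ler_pdivrMr// mulrC.
  by have := LF b a bI aI; rewrite !ger0_norm ?subr_ge0//; exact: mF.
have db : d <= b.
  by rewrite /d gerBl divr_ge0 ?(ltW K0)// subr_ge0; exact: mF.
have iF := lipschitz_on_integrable LF.
have sub x : d <= x <= b -> x \in `[a, b].
  by move=> /andP[dx xb]; rewrite in_itv/= xb (le_trans ad).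
rewrite (Rintegral_segment_split iF (x := d)) ?ad//.
have -> : F a * (b - a) + (F b - F a) ^+ 2 / (2 * K) =
    F a * (d - a) + (F a * (b - d) + K * (b - d) ^+ 2 / 2).
  by rewrite -Kd; field.
rewrite -(Rintegral_segment_cst _ ad) -Rintegral_segment_affine ?(ltW K0)//.
apply: lerD; apply: le_Rintegral => //.
- apply: (@lipschitz_on_integrable _ _ _ K) => x y _ _.
  by rewrite subrr normr0 mulr_ge0// ltW.
- by apply: lipschitz_on_integrable (lipschitz_onS _ _ LF).
- move=> x /=; rewrite in_itv/= => /andP[ax xd]; apply: mF => //.
  by rewrite in_itv/= ax (le_trans xd).
- by apply: (@lipschitz_on_integrable _ _ _ K); apply: lipschitz_on_affine; lra.
- by apply: lipschitz_on_integrable (lipschitz_onS _ _ LF).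
- move=> x /=; rewrite in_itv/= => dxb; have xI := sub x dxb.
  have /andP[dx xb] := dxb.
  have := LF b x bI xI; rewrite !ger0_norm ?subr_ge0//; last exact: mF.
  have -> : K * (b - x) = F b - F a - K * (x - d) by rewrite -Kd; ring.
  lra.
Qed.

(** * Ramps, residual demand and the reduced profit *)

(** The supply function that is zero up to the price [a] and then climbs with
    slope [K]: it earns the most among the supply functions that sell a given
    quantity at a given clearing price. *)
Definition ramp (R : realType) (K a x : R) : R := Num.max 0 (K * (x - a)).

Lemma rampE (R : realType) (K a x : R) : 0 < K ->
  ramp K a x = if a <= x then K * (x - a) else 0.
Proof.
move=> K0; rewrite /ramp; case: ifPn => [ax|]; last rewrite -ltNge => xa.
  by rewrite max_r// mulr_ge0 ?subr_ge0// ltW.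
by rewrite max_l// pmulr_rle0// subr_le0 ltW.
Qed.

Lemma ramp_Lip_supply (R : realType) (phat K a : R) : 0 < K -> 0 <= a ->
  Lip_supply phat K (ramp K a).
Proof.
move=> K0 a0; have mr (x y : R) : x <= y -> ramp K a x <= ramp K a y.
  by move=> xy; rewrite /ramp ge_max !le_max lexx/= ler_pM2l// lerB// orbT.
split.
- rewrite rampE//; case: ifPn => // a0'.
  by have -> : a = 0 by [apply/le_anti/andP]; rewrite subrr mulr0.
- by move=> x _; rewrite le_max lexx.
- by move=> x y _ _; exact: mr.
- move=> x y _ _; wlog xy : x y / x <= y => [h|].
    have [|/ltW] := leP x y; first exact: h.
    by rewrite distrC (distrC x y); exact: h.
  rewrite distrC (distrC x y) !ger0_norm ?subr_ge0//; last exact: mr.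
  rewrite lerBlDr ge_max; apply/andP; split.
    by rewrite addr_ge0 ?le_max ?lexx// mulr_ge0 ?subr_ge0// ltW.
  have : K * (x - a) <= ramp K a x by rewrite le_max lexx orbT.
  lra.
Qed.

Lemma Rintegral_ramp (R : realType) (K a p : R) : 0 < K -> 0 <= a <= p ->
  \int[lebesgue_measure]_(x in `[0, p]) ramp K a x =
  (ramp K a p) ^+ 2 / (2 * K).
Proof.
move=> K0 /andP[a0 ap]; have [_ _ _ Lr] := ramp_Lip_supply p K0 a0.
rewrite (Rintegral_segment_split (lipschitz_on_integrable Lr) (x := a)) ?a0//.
have -> : \int[lebesgue_measure]_(x in `[0, a]) ramp K a x =
    \int[lebesgue_measure]_(x in `[0, a]) (0 : R).
  apply: eq_Rintegral => x; rewrite inE/= in_itv/= => /andP[_ xa].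
  rewrite rampE//; case: ifPn => // ax.
  by have -> : a = x by [apply/le_anti/andP]; rewrite subrr mulr0.
have -> : \int[lebesgue_measure]_(x in `[a, p]) ramp K a x =
    \int[lebesgue_measure]_(x in `[a, p]) (0 + K * (x - a)).
  apply: eq_Rintegral => x; rewrite inE/= in_itv/= => /andP[ax _].
  by rewrite rampE// ax add0r.
rewrite Rintegral_segment_cst// mul0r add0r.
rewrite Rintegral_segment_affine ?(ltW K0)// rampE// ap; field.
by rewrite gt_eqF.
Qed.

(** The demand left to player [i] at price [p] once the others are served; it
    does not depend on the supply function of [i]. *)
Definition residual_demand (R : realType) (n : nat) (gamma phat : R)
    (S : 'I_n -> R -> R) (i : 'I_n) (p : R) : R :=
  affine_demand gamma phat p - \sum_(j < n | j != i) S j p.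

(** The profit from selling [q] at the clearing price [p] through a ramp of
    slope [K], when the cost is quadratic with coefficient [c] and
    [kappa = c + 1 / K]. *)
Definition bid_profit (R : realType) (kappa p q : R) : R :=
  p * q - kappa * q ^+ 2 / 2.

Lemma clears_residual (R : realType) (n : nat) (gamma phat : R)
    (S : 'I_n -> R -> R) (i : 'I_n) (p : R) :
  clears gamma phat S p <->
  p \in `[0, phat] /\ S i p = residual_demand gamma phat S i p.
Proof.
rewrite /clears /residual_demand (bigD1 i)//=.
by split=> -[pI E]; split=> //; lra.
Qed.

Lemma residual_demand_deviation (R : realType) (n : nat) (gamma phat : R)
    (S : 'I_n -> R -> R) (F : R -> R) (i : 'I_n) (p : R) :
  residual_demand gamma phat [eta S with i |-> F] i p =
  residual_demand gamma phat S i p.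
Proof.
by congr (_ - _); apply: eq_bigr => j /negbTE /= ->.
Qed.

Lemma Lip_supply_deviation (R : realType) (n : nat) (phat K : R)
    (S : 'I_n -> R -> R) (F : R -> R) (i : 'I_n) :
  (forall j, Lip_supply phat K (S j)) -> Lip_supply phat K F ->
  forall j, Lip_supply phat K ([eta S with i |-> F] j).
Proof. by move=> LS LF j /=; case: eqP. Qed.

Lemma Lip_supply_incr (R : realType) (phat K : R) (F : R -> R) (x y : R) :
  Lip_supply phat K F -> 0 <= x -> x <= y -> y <= phat ->
  F x <= F y /\ F y - F x <= K * (y - x).
Proof.
move=> [_ _ mF LF] x0 xy yp.
have xI : x \in `[0, phat] by rewrite in_itv/= x0 (le_trans xy).
have yI : y \in `[0, phat] by rewrite in_itv/= (le_trans x0).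
have h := mF x y xI yI xy; split=> //.
by have := LF y x yI xI; rewrite !ger0_norm ?subr_ge0.
Qed.

Lemma Lip_supply_Rintegral_ge (R : realType) (phat K a b : R) (F : R -> R) :
  0 < K -> Lip_supply phat K F -> 0 <= a -> a <= b -> b <= phat ->
  F a * (b - a) + (F b - F a) ^+ 2 / (2 * K) <=
  \int[lebesgue_measure]_(x in `[a, b]) F x.
Proof.
move=> K0 [_ _ mF LF] a0 ab bp; apply: monotone_Rintegral_ge => //.
  move=> x y; rewrite !in_itv/= => /andP[? ?] /andP[? ?] ?.
  by apply: mF => //; rewrite in_itv/=; apply/andP; split; lra.
exact: lipschitz_onS LF.
Qed.

(** No supply function earns more than the ramp that clears at the same price
    with the same quantity. *)
Lemma utility_le_bid_profit (R : realType) (n : nat) (c : 'I_n -> R)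
    (gamma phat K : R) (S : 'I_n -> R -> R) (i : 'I_n) (p : R) :
  0 < gamma -> 0 < K -> (forall j, Lip_supply phat K (S j)) ->
  clears gamma phat S p ->
  utility c gamma phat S i <= bid_profit (c i + K^-1) p (S i p).
Proof.
move=> g0 K0 LS cp; rewrite /utility (clearing_priceE g0 _ cp); last first.
  by move=> j; have [] := LS j.
have [/andP[p0 pp] _] := cp; have [S0 _ _ _] := LS i.
have := Lip_supply_Rintegral_ge K0 (LS i) (lexx 0) p0 pp.
have -> : S i 0 * (p - 0) + (S i p - S i 0) ^+ 2 / (2 * K) =
    K^-1 * (S i p) ^+ 2 / 2 by rewrite S0; field; rewrite gt_eqF.
rewrite /bid_profit /quadratic_cost; lra.
Qed.

Lemma utility_ramp (R : realType) (n : nat) (c : 'I_n -> R)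
    (gamma phat K a : R) (S : 'I_n -> R -> R) (i : 'I_n) (p : R) :
  0 < gamma -> 0 < K -> (forall j, Lip_supply phat K (S j)) ->
  clears gamma phat S p -> S i = ramp K a -> 0 <= a <= p ->
  utility c gamma phat S i = bid_profit (c i + K^-1) p (S i p).
Proof.
move=> g0 K0 LS cp Si ap; rewrite /utility (clearing_priceE g0 _ cp); last first.
  by move=> j; have [] := LS j.
rewrite Si Rintegral_ramp// /bid_profit /quadratic_cost; field.
by rewrite gt_eqF.
Qed.

(** * Necessary conditions for a Nash equilibrium *)

(** The largest rate at which a residual demand can decrease: the slope of the
    demand plus [K] for each of the [n - 1] competitors. *)
Definition residual_slope (R : realType) (n : nat) (gamma K : R) : R :=
  gamma + K * n.-1%:R.

Lemma sum_others_cst (R : realType) (n : nat) (i : 'I_n) (x : R) :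
  \sum_(j < n | j != i) x = x * n.-1%:R.
Proof.
by rewrite sumr_const cardC1 card_ord mulr_natr.
Qed.

Lemma residual_slope_gt0 (R : realType) (n : nat) (gamma K : R) :
  0 < gamma -> 0 < K -> 0 < residual_slope n gamma K.
Proof. by move=> g0 K0; rewrite /residual_slope ltr_wpDr// mulr_ge0// ltW. Qed.

Lemma residual_demand_drop (R : realType) (n : nat) (gamma phat K : R)
    (S : 'I_n -> R -> R) (i : 'I_n) (x y : R) :
  (forall j, Lip_supply phat K (S j)) -> 0 <= x -> x <= y -> y <= phat ->
  gamma * (y - x)
  <= residual_demand gamma phat S i x - residual_demand gamma phat S i y
  <= residual_slope n gamma K * (y - x).
Proof.
move=> LS x0 xy yp.
have -> : residual_demand gamma phat S i x - residual_demand gamma phat S i y =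
    gamma * (y - x) + \sum_(j < n | j != i) (S j y - S j x).
  by rewrite /residual_demand /affine_demand sumrB; ring.
have -> : residual_slope n gamma K * (y - x) =
    gamma * (y - x) + \sum_(j < n | j != i) K * (y - x).
  by rewrite sum_others_cst /residual_slope; ring.
rewrite lerDl lerD2l sumr_ge0/=; last first.
  by move=> j _; rewrite subr_ge0; have [] := Lip_supply_incr (LS j) x0 xy yp.
by apply: ler_sum => j _; have [] := Lip_supply_incr (LS j) x0 xy yp.
Qed.

(** A player may deviate to any point of the residual demand curve that a
    [K]-Lipschitz supply function can reach, by using a ramp. *)
Lemma Nash_deviation (R : realType) (n : nat) (c : 'I_n -> R)
    (gamma phat K : R) (S : 'I_n -> R -> R) (i : 'I_n) (p : R) :
  0 < gamma -> 0 < K -> Nash_equilibrium c gamma phat K S ->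
  p \in `[0, phat] -> 0 <= residual_demand gamma phat S i p <= K * p ->
  bid_profit (c i + K^-1) p (residual_demand gamma phat S i p) <=
  utility c gamma phat S i.
Proof.
move=> g0 K0 [LS NS] pI; set r := residual_demand _ _ _ _ _ => /andP[r0 rKp].
have Kn0 : K != 0 by rewrite gt_eqF.
have a0 : 0 <= p - r / K by rewrite subr_ge0 ler_pdivrMr// mulrC.
have ap : p - r / K <= p by rewrite gerBl divr_ge0// ltW.
have LF := ramp_Lip_supply phat K0 a0; set F := ramp K _ in LF.
have Fp : F p = r by rewrite /F rampE// ap; field.
apply: (le_trans _ (NS i F LF)).
have LS' := Lip_supply_deviation i LS LF.
set S' := (X in forall j, _ _ _ (X j)) in LS'.
have S'i : S' i = F by rewrite /S' /= eqxx.
rewrite (utility_ramp c g0 K0 LS' _ S'i (p := p)) ?S'i ?Fp ?a0//.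
apply/(clears_residual _ _ _ i); split=> //.
by rewrite residual_demand_deviation S'i.
Qed.

Lemma Nash_utility (R : realType) (n : nat) (c : 'I_n -> R)
    (gamma phat K : R) (S : 'I_n -> R -> R) (i : 'I_n) (p : R) :
  0 < gamma -> 0 < K -> Nash_equilibrium c gamma phat K S ->
  clears gamma phat S p ->
  utility c gamma phat S i = bid_profit (c i + K^-1) p (S i p).
Proof.
move=> g0 K0 NS cp; have [LS _] := NS; apply/le_anti/andP; split.
  exact: utility_le_bid_profit LS cp.
have /(clears_residual _ _ _ i)[pI E] := cp.
have /andP[p0 pp] : 0 <= p <= phat := pI.
rewrite E; apply: Nash_deviation => //; rewrite -E.
have [S0 _ _ _] := LS i.
by have := Lip_supply_incr (LS i) (lexx 0) p0 pp; rewrite S0 !subr0 => -[-> ->].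
Qed.

Lemma Nash_bid_profit_max (R : realType) (n : nat) (c : 'I_n -> R)
    (gamma phat K : R) (S : 'I_n -> R -> R) (i : 'I_n) (p x : R) :
  0 < gamma -> 0 < K -> Nash_equilibrium c gamma phat K S ->
  clears gamma phat S p ->
  x \in `[0, phat] -> 0 <= residual_demand gamma phat S i x <= K * x ->
  bid_profit (c i + K^-1) x (residual_demand gamma phat S i x) <=
  bid_profit (c i + K^-1) p (S i p).
Proof.
move=> g0 K0 NS cp xI rx; rewrite -(Nash_utility i g0 K0 NS cp).
exact: Nash_deviation.
Qed.

(** Below the clearing price an equilibrium supply function has the maximal
    slope [K] wherever it is positive: a point [(x, S i x)] strictly above the
    line of slope [K] would increase the area under [S i] beyond its minimum. *)
Lemma Nash_steep (R : realType) (n : nat) (c : 'I_n -> R)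
    (gamma phat K : R) (S : 'I_n -> R -> R) (i : 'I_n) (p x : R) :
  0 < gamma -> 0 < K -> Nash_equilibrium c gamma phat K S ->
  clears gamma phat S p -> 0 <= x -> x <= p -> 0 < S i x ->
  S i x = S i p - K * (p - x).
Proof.
move=> g0 K0 NS cp x0 xp sx; have [LS _] := NS.
have [pI _] := cp; have /andP[p0 pp] : 0 <= p <= phat := pI.
have [S0 _ _ LSi] := LS i.
have Kn0 : K != 0 by rewrite gt_eqF.
have [qs qsK] := Lip_supply_incr (LS i) x0 xp pp.
have xpp : x <= phat by exact: le_trans xp pp.
(* Bounding the area from below separately on [0, x] and [x, p]. *)
have I1 := Lip_supply_Rintegral_ge K0 (LS i) (lexx 0) x0 xpp.
have I2 := Lip_supply_Rintegral_ge K0 (LS i) x0 xp pp.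
have := Nash_utility i g0 K0 NS cp.
rewrite /utility (clearing_priceE g0 _ cp); last by move=> j; have [] := LS j.
rewrite (Rintegral_segment_split _ (x := x)) ?x0//; last first.
  by apply: (lipschitz_on_integrable (K := K)); apply: lipschitz_onS LSi.
move: I1 I2; rewrite S0 mul0r add0r subr0.
set I1 := (X in _ <= X -> _); set I2 := (X in _ -> _ <= X -> _).
move=> h1 h2; rewrite -/I1 -/I2 /bid_profit /quadratic_cost => h3.
have h : I1 + I2 = (S i p) ^+ 2 / (2 * K).
  have -> : (S i p) ^+ 2 / (2 * K) = K^-1 * S i p ^+ 2 / 2 by field.
  lra.
have : S i x * (K * (p - x) - (S i p - S i x)) <= 0.
  have -> : S i x * (K * (p - x) - (S i p - S i x)) =
      K * (S i x ^+ 2 / (2 * K) +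
        (S i x * (p - x) + (S i p - S i x) ^+ 2 / (2 * K)) -
        (S i p) ^+ 2 / (2 * K)) by field.
  by rewrite pmulr_rle0// -h subr_le0 lerD.
rewrite pmulr_rle0//; lra.
Qed.

Lemma le_of_le_small_step (R : realType) (x y C d0 : R) : 0 < C -> 0 < d0 ->
  (forall d, 0 < d -> d <= d0 -> x <= y + d * C) -> x <= y.
Proof.
move=> C0 d0_gt0 h; rewrite leNgt; apply/negP => yx.
pose d := Num.min d0 ((x - y) / (2 * C)).
have d_gt0 : 0 < d by rewrite lt_min d0_gt0 divr_gt0 ?subr_gt0// mulr_gt0.
have dC : d * C <= (x - y) / 2.
  rewrite -ler_pdivlMr//; have -> : (x - y) / 2 / C = (x - y) / (2 * C).
    by field; rewrite gt_eqF.
  by rewrite /d ge_min lexx orbT.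
have := h d d_gt0; rewrite /d ge_min lexx/= -/d => /(_ isT); lra.
Qed.

Lemma clears_gt0 (R : realType) (n : nat) (gamma phat K : R)
    (S : 'I_n -> R -> R) (p : R) :
  0 < gamma -> 0 < phat -> (forall j, Lip_supply phat K (S j)) ->
  clears gamma phat S p -> 0 < p.
Proof.
move=> g0 ph0 LS [pI E]; have /andP[p0 _] : 0 <= p <= phat := pI.
rewrite lt_neqAle p0 andbT.
apply/eqP => p0'; move: E; rewrite -p0' big1 => [|j _]; last by have [] := LS j.
move/eqP; rewrite /affine_demand subr0 mulf_eq0 !gt_eqF//.
Qed.

(** An idle player would gain by lowering the price slightly and selling a small
    quantity. *)
Lemma Nash_sold_gt0 (R : realType) (n : nat) (c : 'I_n -> R)
    (gamma phat K : R) (S : 'I_n -> R -> R) (i : 'I_n) (p : R) :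
  0 < gamma -> 0 < phat -> 0 < K -> 0 < c i ->
  Nash_equilibrium c gamma phat K S -> clears gamma phat S p -> 0 < S i p.
Proof.
move=> g0 ph0 K0 c0 NS cp; have [LS _] := NS.
have p_gt0 := clears_gt0 g0 ph0 LS cp; have Kn0 : K != 0 by rewrite gt_eqF.
have /(clears_residual _ _ _ i)[pI E] := cp.
have /andP[p0 pp] : 0 <= p <= phat := pI.
have [_ S0 _ _] := LS i; have := S0 p pI; rewrite le_eqVlt => /predU1P[q0|//].
have G0 := residual_slope_gt0 n g0 K0.
set G := residual_slope n gamma K in G0.
set kappa := c i + K^-1; have k0 : 0 < kappa by rewrite addr_gt0 ?invr_gt0.
(* The step [d] is chosen so that [p - d = d * M]: the price stays large enough,
   relative to the quantity [t <= G * d], for [t] to be reachable with slope [K]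
   and for the marginal profit to be positive. *)
pose M := G / K + kappa * G.
have M0 : 0 < M by rewrite addr_gt0// ?divr_gt0// mulr_gt0.
pose d := p / (1 + M).
have d0 : 0 < d by rewrite divr_gt0// ltr_wpDl.
have dM : p - d = d * M by rewrite /d; field; rewrite gt_eqF// ltr_wpDl.
have x0 : 0 <= p - d by rewrite dM mulr_ge0// ltW.
have xp : p - d <= p by rewrite gerBl ltW.
have /andP[] := residual_demand_drop gamma i LS x0 xp pp.
rewrite -E -q0 subr0 subKr -/G.
set t := residual_demand _ _ _ _ _ => t1 t2.
have t0 : 0 < t by rewrite (lt_le_trans _ t1)// mulr_gt0.
have kt : kappa * t <= kappa * (G * d) by rewrite ler_pM2l.
have GKd : 0 < G / K * d by rewrite mulr_gt0// divr_gt0.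
have kGd : 0 < kappa * (G * d) by rewrite mulr_gt0// mulr_gt0.
have E2 : p - d = G / K * d + kappa * (G * d) by rewrite dM /M; ring.
have : bid_profit kappa (p - d) t <= bid_profit kappa p (S i p).
  apply: Nash_bid_profit_max => //.
    by rewrite in_itv/= x0 (le_trans xp).
  rewrite -/t (ltW t0)/= (le_trans t2)// E2.
  have -> : K * (G / K * d + kappa * (G * d)) = G * d + K * (kappa * (G * d)).
    by field.
  by rewrite lerDl mulr_ge0 ?ltW.
rewrite /bid_profit -q0 expr0n /= !mulr0 mul0r subr0.
have -> : (p - d) * t - kappa * t ^+ 2 / 2 = t * (p - d - kappa * t / 2) by ring.
rewrite pmulr_rle0// E2; lra.
Qed.

(** The first-order condition from raising the price.  The supply functions need
    not be differentiable at [p]; only the bound [residual_slope] on the rate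
    of decrease of the residual demand is available there. *)
Lemma Nash_right_deviation (R : realType) (n : nat) (c : 'I_n -> R)
    (gamma phat K : R) (S : 'I_n -> R -> R) (i : 'I_n) (p : R) :
  0 < gamma -> 0 < phat -> 0 < K -> (forall j, 0 < c j) ->
  Nash_equilibrium c gamma phat K S -> clears gamma phat S p ->
  S i p <= residual_slope n gamma K * (p - (c i + K^-1) * S i p).
Proof.
move=> g0 ph0 K0 c0 NS cp; have [LS _] := NS.
have q0 j : 0 < S j p by exact: Nash_sold_gt0 (c0 j) NS cp.
have p_gt0 := clears_gt0 g0 ph0 LS cp.
have /(clears_residual _ _ _ i)[pI E] := cp.
have /andP[p0 pp] : 0 <= p <= phat := pI.
have p_lt : p < phat.
  have [_ E1] := cp; have : 0 < affine_demand gamma phat p.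
    by rewrite E1 (bigD1 i)//= ltr_pwDl// sumr_ge0// => j _; exact: ltW.
  by rewrite /affine_demand pmulr_rgt0// subr_gt0.
have G0 := residual_slope_gt0 n g0 K0.
set G := residual_slope n gamma K in G0 *; set q := S i p in E *.
set kappa := c i + K^-1; have k0 : 0 < kappa by rewrite addr_gt0 ?invr_gt0 ?c0.
have [S0 _ _ _] := LS i.
have qK : q <= K * p.
  by have [_] := Lip_supply_incr (LS i) (lexx 0) p0 pp; rewrite S0 !subr0.
(* The sign of [p - kappa * q] is not known yet; the positive part covers both
   cases, and [q > 0] then excludes the nonpositive one. *)
suff h : q <= G * Num.max 0 (p - kappa * q).
  have [le0|gt0] := leP (p - kappa * q) 0; last by rewrite max_r ?(ltW gt0) in h.
  by move: h; rewrite max_l// mulr0 leNgt q0.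
set A := Num.max _ _; have A0 : 0 <= A by rewrite le_max lexx.
have AE : p - kappa * q <= A by rewrite le_max lexx orbT.
apply: (@le_of_le_small_step _ _ _ (G + kappa * G ^+ 2 / 2)
         (Num.min (phat - p) (q / G))).
- by rewrite ltr_wpDr// !mulr_ge0 ?sqr_ge0// ltW.
- by rewrite lt_min subr_gt0 p_lt divr_gt0//; exact: q0.
move=> d d0; rewrite le_min ler_pdivlMr// => /andP[d1 d2].
have xp : p <= p + d by rewrite lerDl ltW.
have xpp : p + d <= phat by lra.
have /andP[] := residual_demand_drop gamma i LS p0 xp xpp.
rewrite -E (addrC p) addrK -/G -(addrC p).
pose t := q - residual_demand gamma phat S i (p + d); rewrite -/t => t1 t2.
have rE : residual_demand gamma phat S i (p + d) = q - t by rewrite /t; ring.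
have gd : 0 < gamma * d by rewrite mulr_gt0.
have : bid_profit kappa (p + d) (q - t) <= bid_profit kappa p q.
  rewrite -rE; apply: Nash_bid_profit_max => //.
    by rewrite in_itv/= xpp (le_trans p0).
  rewrite rE; apply/andP; split; first lra.
  have : 0 < K * d by rewrite mulr_gt0.
  rewrite mulrDr; lra.
rewrite /bid_profit => h.
have h1 : d * q <= t * (p - kappa * q) + d * t + kappa * t ^+ 2 / 2 by lra.
have t0 : 0 <= t by lra.
have h2 : t * (p - kappa * q) <= (G * d) * A.
  by apply: (@le_trans _ _ (t * A)); [rewrite ler_wpM2l|rewrite ler_wpM2r].
have h3 : d * t <= d * (G * d) by rewrite ler_pM2l.
have h4 : kappa * t ^+ 2 <= kappa * (G * d) ^+ 2.
  by rewrite ler_pM2l// ler_sqr// nnegrE// mulr_ge0 ?ltW.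
rewrite -(ler_pM2l d0); apply: (le_trans h1).
have -> : d * (G * A + d * (G + kappa * G ^+ 2 / 2)) =
  (G * d) * A + d * (G * d) + kappa * (G * d) ^+ 2 / 2 by ring.
lra.
Qed.

(** The first-order condition from lowering the price.  It uses that all
    supply functions have slope exactly [K] just below [p]. *)
Lemma Nash_left_deviation (R : realType) (n : nat) (c : 'I_n -> R)
    (gamma phat K : R) (S : 'I_n -> R -> R) (i : 'I_n) (p : R) :
  0 < gamma -> 0 < phat -> 0 < K -> (forall j, 0 < c j) ->
  Nash_equilibrium c gamma phat K S -> clears gamma phat S p ->
  residual_slope n gamma K * (p - (c i + K^-1) * S i p) <= S i p.
Proof.
move=> g0 ph0 K0 c0 NS cp; have [LS _] := NS.
have q0 j : 0 < S j p by exact: Nash_sold_gt0 (c0 j) NS cp.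
have p_gt0 := clears_gt0 g0 ph0 LS cp.
have := Nash_right_deviation i g0 ph0 K0 c0 NS cp.
have /(clears_residual _ _ _ i)[pI E] := cp.
have /andP[p0 pp] : 0 <= p <= phat := pI.
have G0 := residual_slope_gt0 n g0 K0; have qi0 := q0 i.
set G := residual_slope n gamma K in G0 *; set q := S i p in E qi0 *.
set kappa := c i + K^-1; have k0 : 0 < kappa by rewrite addr_gt0 ?invr_gt0 ?c0.
move=> hr.
(* Strictness leaves room to sell more at a lower price; it comes from the
   condition on the right, which forces [kappa * q < p]. *)
have qK : q < K * p.
  have kq : kappa * q < p.
    by rewrite -subr_gt0 -(pmulr_rgt0 _ G0) (lt_le_trans _ hr).
  have -> : q = K * (K^-1 * q) by rewrite mulrA divff ?mul1r// gt_eqF.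
  rewrite ltr_pM2l//; apply: lt_trans kq.
  by rewrite ltr_pM2r// /kappa ltrDr.
(* For steps below [m / K] all supplies remain positive, hence on their line of
   slope [K]. *)
pose m := \big[Num.min/q]_(j < n) S j p.
have m0 : 0 < m by apply: lt_bigmin => // j _; exact: q0.
have mS j : m <= S j p by exact: bigmin_le.
apply: (@le_of_le_small_step _ _ _ (G + kappa * G ^+ 2 / 2)
         (Num.min (m / (2 * K)) ((K * p - q) / (G + K)))).
- by rewrite ltr_wpDr// !mulr_ge0 ?sqr_ge0// ltW.
- rewrite lt_min; apply/andP; split; first by rewrite divr_gt0// mulr_gt0.
  by rewrite divr_gt0 ?subr_gt0// addr_gt0.
move=> d d0; rewrite le_min ler_pdivlMr ?mulr_gt0//.
rewrite ler_pdivlMr ?(addr_gt0 G0 K0)//.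
move=> /andP[d1 d2].
have Kd : 0 < K * d by rewrite mulr_gt0.
have Gd : 0 < G * d by rewrite mulr_gt0.
have x0 : 0 <= p - d by rewrite -(pmulr_rge0 _ K0) mulrBr; lra.
have xp : p - d <= p by rewrite gerBl ltW.
have Sd j : S j (p - d) = S j p - K * d.
  have [_ h] := Lip_supply_incr (LS j) x0 xp pp; rewrite subKr in h.
  have sp : 0 < S j (p - d) by have := mS j; lra.
  by rewrite (Nash_steep g0 K0 NS cp x0 xp sp) subKr.
have rE : residual_demand gamma phat S i (p - d) = q + G * d.
  rewrite E /residual_demand /affine_demand.
  under eq_bigr do rewrite Sd.
  by rewrite sumrB sum_others_cst /G /residual_slope; ring.
have : bid_profit kappa (p - d) (q + G * d) <= bid_profit kappa p q.
  rewrite -rE; apply: Nash_bid_profit_max => //.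
    by rewrite in_itv/= x0 (le_trans xp).
  rewrite rE; apply/andP; split; first lra.
  rewrite mulrBr; lra.
rewrite /bid_profit => h; rewrite -(ler_pM2l d0); lra.
Qed.

(** * The equilibrium price *)

(** The quantity sold at equilibrium per unit of the clearing price, by a player
    with cost coefficient [ci]. *)
Definition equilibrium_slope (R : realType) (n : nat) (gamma K ci : R) : R :=
  (ci + K^-1 + (residual_slope n gamma K)^-1)^-1.

(** The common clearing price of all equilibria. *)
Definition equilibrium_price (R : realType) (n : nat) (c : 'I_n -> R)
    (gamma phat K : R) : R :=
  gamma * phat / (gamma + \sum_(i < n) equilibrium_slope n gamma K (c i)).

Lemma equilibrium_slope_gt0 (R : realType) (n : nat) (gamma K ci : R) :
  0 < gamma -> 0 < K -> 0 < ci -> 0 < equilibrium_slope n gamma K ci.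
Proof.
move=> g0 K0 c0; have G0 := residual_slope_gt0 n g0 K0.
by rewrite /equilibrium_slope invr_gt0 !addr_gt0 ?invr_gt0.
Qed.

Lemma clears_linear_price (R : realType) (n : nat) (gamma phat p : R)
    (S : 'I_n -> R -> R) (b : 'I_n -> R) :
  0 < gamma -> (forall i, 0 <= b i) -> (forall i, S i p = b i * p) ->
  affine_demand gamma phat p = \sum_(i < n) S i p ->
  p = gamma * phat / (gamma + \sum_(i < n) b i).
Proof.
move=> g0 b0 Sb; under eq_bigr do rewrite Sb.
have B0 : 0 <= \sum_(i < n) b i by rewrite sumr_ge0.
rewrite -mulr_suml /affine_demand => E.
have -> : gamma * phat = p * (gamma + \sum_(i < n) b i) by lra.
by field; rewrite gt_eqF// ltr_wpDr.
Qed.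

Lemma linear_price_clears (R : realType) (n : nat) (gamma phat : R)
    (b : 'I_n -> R) :
  0 < gamma -> 0 < phat -> (forall i, 0 <= b i) ->
  let p := gamma * phat / (gamma + \sum_(i < n) b i) in
  p \in `[0, phat] /\ affine_demand gamma phat p = \sum_(i < n) b i * p.
Proof.
move=> g0 ph0 b0 p.
have B0 : 0 <= \sum_(i < n) b i by rewrite sumr_ge0.
have D0 : 0 < gamma + \sum_(i < n) b i by rewrite ltr_wpDr.
split.
  rewrite in_itv/=; apply/andP; split.
    by rewrite divr_ge0 ?mulr_ge0// ltW.
  by rewrite ler_pdivrMr// mulrC ler_pM2l// lerDl.
rewrite -mulr_suml /affine_demand /p; field; rewrite gt_eqF//.
Qed.

Lemma Nash_quantity (R : realType) (n : nat) (c : 'I_n -> R)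
    (gamma phat K : R) (S : 'I_n -> R -> R) (i : 'I_n) (p : R) :
  0 < gamma -> 0 < phat -> 0 < K -> (forall j, 0 < c j) ->
  Nash_equilibrium c gamma phat K S -> clears gamma phat S p ->
  S i p = equilibrium_slope n gamma K (c i) * p.
Proof.
move=> g0 ph0 K0 c0 NS cp.
have hr := Nash_right_deviation i g0 ph0 K0 c0 NS cp.
have hl := Nash_left_deviation i g0 ph0 K0 c0 NS cp.
have G0 := residual_slope_gt0 n g0 K0.
have := equilibrium_slope_gt0 n g0 K0 (c0 i); rewrite /equilibrium_slope.
move: hr hl G0; set G := residual_slope n gamma K; set kappa := c i + K^-1.
rewrite invr_gt0 => hr hl G0 D0.
have E : S i p = G * (p - kappa * S i p) by apply/le_anti; rewrite hr hl.
have pE : p = (kappa + G^-1) * S i p.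
  by apply: (mulfI (lt0r_neq0 G0)); rewrite mulrA mulrDr divff ?gt_eqF//; lra.
by rewrite [X in _ = _ * X]pE mulrA mulVf ?mul1r// gt_eqF.
Qed.

Lemma Nash_price (R : realType) (n : nat) (c : 'I_n -> R)
    (gamma phat K : R) (S : 'I_n -> R -> R) :
  0 < gamma -> 0 < phat -> 0 < K -> (forall j, 0 < c j) ->
  Nash_equilibrium c gamma phat K S ->
  clearing_price gamma phat S = equilibrium_price c gamma phat K.
Proof.
move=> g0 ph0 K0 c0 NS; have [LS _] := NS.
have cp := clearing_price_clears g0 ph0 LS; have [_ E] := cp.
apply: (clears_linear_price g0 _ _ E) => i.
  exact/ltW/equilibrium_slope_gt0.
exact: Nash_quantity NS cp.
Qed.

(** If the first-order condition [p = (kappa + G^-1) * q] holds, then [(p, q)]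
    maximizes the profit over all points below the line of slope [- G] through
    it: raising the price at a fixed quantity moves a point onto the line, and
    on the line the loss is [(G^-1 + kappa / 2) * (q - y) ^+ 2]. *)
Lemma bid_profit_tangent (R : realType) (G kappa p q x y : R) :
  0 < G -> 0 < kappa -> p = (kappa + G^-1) * q ->
  0 <= y -> y <= q - G * (x - p) ->
  bid_profit kappa x y <= bid_profit kappa p q.
Proof.
move=> G0 k0 pE y0 yx.
have hx : x <= p + (q - y) / G.
  by rewrite -lerBlDl ler_pdivlMr// mulrC; lra.
rewrite /bid_profit; apply: (@le_trans _ _ ((p + (q - y) / G) * y -
    kappa * y ^+ 2 / 2)); first by rewrite lerB// ler_wpM2r.
rewrite -subr_ge0.
have -> : p * q - kappa * q ^+ 2 / 2 -
    ((p + (q - y) / G) * y - kappa * y ^+ 2 / 2) =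
    (G^-1 + kappa / 2) * (q - y) ^+ 2.
  by rewrite pE; field; rewrite gt_eqF.
by rewrite mulr_ge0 ?sqr_ge0// addr_ge0 ?divr_ge0 ?invr_ge0// ltW.
Qed.

Lemma Nash_exists (R : realType) (n : nat) (c : 'I_n -> R)
    (gamma phat K : R) :
  0 < gamma -> 0 < phat -> 0 < K -> (forall j, 0 < c j) ->
  exists S, Nash_equilibrium c gamma phat K S.
Proof.
move=> g0 ph0 K0 c0; have G0 := residual_slope_gt0 n g0 K0.
pose b i := equilibrium_slope n gamma K (c i).
have b0 i : 0 < b i by exact: equilibrium_slope_gt0.
have [] := linear_price_clears g0 ph0 (fun i => ltW (b0 i)).
set p := (_ / _) => pI pE; have /andP[p0 pp] : 0 <= p <= phat := pI.
have Kn0 : K != 0 by rewrite gt_eqF.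
have bK i : b i <= K.
  rewrite -[leRHS]invrK /b /equilibrium_slope lef_pV2 ?posrE ?invr_gt0//.
    by rewrite -addrA addrCA lerDl addr_ge0 ?invr_ge0 ?ltW.
  by rewrite !addr_gt0 ?invr_gt0.
(* The ramp of slope [K] from [a i] passes through [(p, b i * p)]. *)
pose a i := p - b i * p / K.
have a0 i : 0 <= a i.
  by rewrite /a subr_ge0 ler_pdivrMr// mulrC ler_wpM2l.
have ap i : a i <= p.
  by rewrite /a gerBl; apply: divr_ge0 (ltW K0); apply: mulr_ge0 (ltW (b0 i)) _.
pose S i := ramp K (a i).
have Sx i x : p <= x -> S i x = b i * p + K * (x - p).
  by move=> px; rewrite /S rampE// (le_trans (ap i))// /a; field.
have Sp i : S i p = b i * p by rewrite Sx// subrr mulr0 addr0.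
have LS i : Lip_supply phat K (S i) by exact: ramp_Lip_supply.
have cp : clears gamma phat S p.
  by split=> //; under eq_bigr do rewrite Sp.
exists S; split=> // i F LF.
have LS' := Lip_supply_deviation i LS LF.
have cx := clearing_price_clears g0 ph0 LS'.
set x := clearing_price _ _ _ in cx.
apply: (le_trans (utility_le_bid_profit c i g0 K0 LS' cx)).
rewrite (utility_ramp c g0 K0 LS cp (erefl (S i))) ?a0 ?ap//= eqxx Sp.
have /(clears_residual _ _ _ i)[xI] := cx.
rewrite residual_demand_deviation/= eqxx => Fx.
have /andP[x0 xp] : 0 <= x <= phat := xI.
have k0 : 0 < c i + K^-1 by rewrite addr_gt0 ?invr_gt0.
apply: (bid_profit_tangent G0 k0).
- rewrite mulrA /b /equilibrium_slope mulfV ?mul1r// gt_eqF//.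
  by rewrite addr_gt0 ?invr_gt0.
- by have [_ + _ _] := LF; apply.
have /(clears_residual _ _ _ i)[_ Ep] := cp.
(* Left of [p] the Lipschitz bound gives the tangent inequality; right of [p]
   all ramps are climbing, so the residual demand is on the tangent. *)
rewrite Fx -Sp Ep; have [px|/ltW px] := leP x p.
  have /andP[_] := residual_demand_drop gamma i LS x0 px pp; lra.
rewrite /residual_demand /affine_demand.
rewrite (eq_bigr (fun j => S j p + K * (x - p))); last first.
  by move=> j _; rewrite Sx// Sp.
rewrite big_split/= sum_others_cst /residual_slope; lra.
Qed.

(** * The limit price and linear supply function equilibria *)

Lemma equilibrium_price_cvg (R : realType) (n : nat) (c : 'I_n -> R)
    (gamma phat : R) :
  (1 < n)%N -> 0 < gamma -> (forall i, 0 < c i) ->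
  equilibrium_price c gamma phat K @[K --> +oo] -->
  gamma * phat / (gamma + \sum_(i < n) 1 / c i).
Proof.
move=> n1 g0 c0.
have V : K^-1 @[K --> (+oo : set_system R)] --> (0 : R).
  by apply/gtr0_cvgV0; [exact: (nbhs_pinfty_gt (num_real _))|exact: cvg_id].
have VG :
    (residual_slope n gamma K)^-1 @[K --> (+oo : set_system R)] --> (0 : R).
  apply/gtr0_cvgV0.
    by near=> K; apply: residual_slope_gt0 => //; near: K;
      exact: (nbhs_pinfty_gt (num_real _)).
  apply/cvgryPge => A; near=> K.
  have K0 : 0 <= K by near: K; exact: (nbhs_pinfty_ge (num_real _)).
  have AK : A <= K by near: K; exact: (nbhs_pinfty_ge (num_real _)).
  apply: (le_trans AK); rewrite /residual_slope ler_wpDl ?(ltW g0)//.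
  by rewrite ler_peMr// ler1n; case: (n) n1 => [|[]].
have D0 : gamma + \sum_(i < n) 1 / c i != 0.
  by rewrite gt_eqF// ltr_wpDr// sumr_ge0// => i _; rewrite divr_ge0// ltW.
apply: cvgMr; apply: cvgV => //; apply: cvgD; first exact: cvg_cst.
apply: cvg_big => [|i _]; first exact: add_continuous.
 rewrite div1r; apply: cvgV; first by rewrite gt_eqF.
rewrite -[X in _ --> X]addr0; apply: cvgD => //.
by rewrite -[X in _ --> X]addr0; apply: cvgD => //; exact: cvg_cst.
Unshelve. all: by end_near.
Qed.

Lemma linear_SFE_lt (R : realType) (n : nat) (c : 'I_n -> R)
    (gamma : R) (beta : 'I_n -> R) (i : 'I_n) :
  0 < gamma -> 0 < c i -> linear_SFE c gamma beta -> beta i < 1 / c i.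
Proof.
move=> g0 c0 SFE; have [b0 bE] := SFE i.
rewrite ltr_pdivlMr// mulrC ltNge; apply/negP => cb.
have A0 : 0 < gamma + \sum_(j < n | j != i) beta j.
  by rewrite ltr_wpDr// sumr_ge0// => j _; have [] := SFE j.
have : beta i <= 0 by rewrite bE pmulr_lle0// subr_le0.
move=> b0'; have bi0 : beta i = 0 by apply/le_anti/andP.
by move: cb; rewrite bi0 mulr0 ler10.
Qed.

Theorem mainTheorem11 (R : realType) (n : nat) (c : 'I_n -> R)
    (gamma phat : R) (n_gt0 : (0 < n)%N) (c_gt0 : forall i, 0 < c i)
    (gamma_gt0 : 0 < gamma) (phat_gt0 : 0 < phat) :
  let pinf := gamma * phat / (gamma + \sum_(i < n) 1 / c i) in
  (exists pK : R -> R,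
     (forall K, 0 < K -> is_equilibrium_price c gamma phat K (pK K)) /\
     ((1 < n)%N -> pK K @[K --> +oo] --> pinf)) /\
  (forall beta : 'I_n -> R, linear_SFE c gamma beta ->
     let psfe := clearing_price gamma phat (linear_supply beta) in
     psfe = gamma * phat / (gamma + \sum_(i < n) beta i) /\
     pinf < psfe).
Proof.
split.
  exists (equilibrium_price c gamma phat); split; last first.
    by move=> n_gt1; exact: equilibrium_price_cvg.
  move=> K K0; split; first exact: Nash_exists.
  by move=> S; exact: Nash_price.
move=> beta SFE psfe; have b0 i : 0 <= beta i by have [] := SFE i.
have psfeE : psfe = gamma * phat / (gamma + \sum_(i < n) beta i).
  apply: clearing_priceE => //; last exact: linear_price_clears.
  by move=> i x y _ _ xy; rewrite /linear_supply ler_wpM2l.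
split=> //; rewrite psfeE ltr_pM2l ?mulr_gt0//.
have B0 : 0 <= \sum_(i < n) beta i by rewrite sumr_ge0.
have lt_sum : \sum_(i < n) beta i < \sum_(i < n) 1 / c i.
  apply: ltr_sum => [|i _]; last exact: linear_SFE_lt SFE.
  by apply/hasP; exists (Ordinal n_gt0); rewrite ?mem_index_enum.
have C0 := le_trans B0 (ltW lt_sum).
by rewrite ltf_pV2 ?ltrD2l// posrE; apply: ltr_wpDr.
Qed.
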